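(* Let $n,p,k$ be positive integers with $k\le \min(n,p)$, $\lambda>0$, $\boldsymbol X\in\mathbb R^{n\times p}$, $\boldsymbol y\in\mathbb R^n$, and let $$v^*=\min_{\boldsymbol\beta\in\mathbb R^p}\left\{\frac1n\|\boldsymbol y-\boldsymbol X\boldsymbol\beta\|_2^2+\lambda\|\boldsymbol\beta\|_2^2:\ \frac1p\sum_{i\in[p]}\mathbb I(|\beta_i|\le 0)\ge 1-\frac kp\right\}.$$ This problem is equivalent to the following mixed integer second order conic problem, i.e. $$v^*=\min_{\boldsymbol\beta,\boldsymbol\mu,\boldsymbol z}\left\{\frac1n\|\boldsymbol y-\boldsymbol X\boldsymbol\beta\|_2^2+\lambda\|\boldsymbol\mu\|_1:\ \sum_{i\in[p]}z_i\le k,\ \beta_i^2\le\mu_iz_i,\ z_i\in\{0,1\},\ \forall i\in[p]\right\},$$ where $\boldsymbol\beta,\boldsymbol\mu,\boldsymbol z\in\mathbb R^p$.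
   Context: $[p]=\{1,\dots,p\}$; $\mathbb I(\cdot)$ is the indicator function (1 if the condition holds, 0 otherwise). The constraint in the first problem says that $\boldsymbol\beta$ has at most $k$ nonzero entries, i.e. $\|\boldsymbol\beta\|_0\le k$. *)

(* Defs.v *)
From mathcomp Require Import all_boot all_order all_algebra.
From mathcomp Require Import classical_sets reals.

Set Implicit Arguments.
Unset Strict Implicit.
Unset Printing Implicit Defensive.

Import Order.TTheory GRing.Theory Num.Theory.

Local Open Scope classical_set_scope.
Local Open Scope ring_scope.

(* The canonical norm on matrices in MathComp-Analysis is the sup norm, hence
   these two. *)
Definition norm1 (R : realType) (m : nat) (v : 'cV[R]_m) : R :=
  \sum_(i < m) `|v i 0|.

Definition norm2 (R : realType) (m : nat) (v : 'cV[R]_m) : R :=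
  Num.sqrt (\sum_(i < m) v i 0 ^+ 2).

(* An attained minimum, not merely an infimum. *)
Definition is_min (R : realType) (T : Type) (D : set T) (f : T -> R) (v : R) :
  Prop := (f @` D) v /\ lbound (f @` D) v.

Definition sparse_feasible (R : realType) (p k : nat) : set 'cV[R]_p :=
  [set beta : 'cV[R]_p |
     1 - k%:R / p%:R <=
     p%:R^-1 * (\sum_(i < p) (`|beta i 0| <= 0)%R%:R) :> R].

Definition sparse_objective (R : realType) (n p : nat) (lambda : R)
    (X : 'M[R]_(n, p)) (y : 'cV[R]_n) (beta : 'cV[R]_p) : R :=
  n%:R^-1 * norm2 (y - X *m beta) ^+ 2 + lambda * norm2 beta ^+ 2.

(* Points are triples (beta, mu, z). *)
Definition misoc_feasible (R : realType) (p k : nat) :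
    set ('cV[R]_p * 'cV[R]_p * 'cV[R]_p) :=
  [set u : 'cV[R]_p * 'cV[R]_p * 'cV[R]_p | let: (beta, mu, z) := u in
     \sum_(i < p) z i 0 <= k%:R /\
     forall i : 'I_p, beta i 0 ^+ 2 <= mu i 0 * z i 0 /\
                      (z i 0 = 0 \/ z i 0 = 1)].

Definition misoc_objective (R : realType) (n p : nat) (lambda : R)
    (X : 'M[R]_(n, p)) (y : 'cV[R]_n)
    (u : 'cV[R]_p * 'cV[R]_p * 'cV[R]_p) : R :=
  let: (beta, mu, z) := u in
  n%:R^-1 * norm2 (y - X *m beta) ^+ 2 + lambda * norm1 mu.

(* Main.v *)
(* For a fixed support [S], the sparse problem is a ridge regression with design
   matrix [X *m proj S]; its normal equations are positive definite, hence
   solvable, and completing the square shows that the solution is a minimizer,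
   which is itself supported on [S]. There are finitely many supports, so the
   minimum is attained. In the conic problem [z] marks the support and the
   constraint forces [beta i ^+ 2 <= mu i], with equality being optimal. *)
Require Import Defs.
From mathcomp Require Import all_boot all_order all_algebra.
From mathcomp Require Import classical_sets reals.
From mathcomp Require Import ring lra.

Set Implicit Arguments.
Unset Strict Implicit.
Unset Printing Implicit Defensive.

Import Order.TTheory GRing.Theory Num.Theory.

Local Open Scope ring_scope.

Lemma norm2_sqr (R : realType) (m : nat) (v : 'cV[R]_m) :
  norm2 v ^+ 2 = \sum_(i < m) v i 0 ^+ 2.
Proof. by rewrite sqr_sqrtr // sumr_ge0 // => i _; rewrite sqr_ge0. Qed.

Lemma norm2_sqr_mul (R : realType) (m : nat) (v : 'cV[R]_m) :
  norm2 v ^+ 2 = (v^T *m v) 0 0.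
Proof.
by rewrite norm2_sqr mxE; apply: eq_bigr => i _; rewrite mxE expr2.
Qed.

Lemma norm2_sqrD (R : realType) (m : nat) (u v : 'cV[R]_m) :
  norm2 (u + v) ^+ 2 = norm2 u ^+ 2 + norm2 v ^+ 2 + 2 * (v^T *m u) 0 0.
Proof.
rewrite !norm2_sqr mxE mulr_sumr -!big_split /=; apply: eq_bigr => i _.
by rewrite !mxE; ring.
Qed.

Lemma norm2_eq0 (R : realType) (m : nat) (v : 'cV[R]_m) :
  norm2 v ^+ 2 = 0 -> v = 0.
Proof.
rewrite norm2_sqr => /eqP; rewrite psumr_eq0 => [|i _]; last exact: sqr_ge0.
move/allP => v0; apply/matrixP => i j; rewrite ord1 mxE.
by apply/eqP; rewrite -sqrf_eq0; apply: v0; rewrite mem_index_enum.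
Qed.

Section Ridge.

Variables (R : realType) (n p : nat) (c lambda : R).
Variables (M : 'M[R]_(n, p)) (y : 'cV[R]_n).
Hypotheses (c_ge0 : 0 <= c) (lambda_gt0 : 0 < lambda).

(** If [v] is in the left kernel, the quadratic form at [v] vanishes. It is a nonnegative term plus
    [lambda * norm2 v^T ^+ 2], so [v] is zero. *)
Lemma ridge_unitmx : c *: (M^T *m M) + lambda%:M \in unitmx.
Proof.
rewrite -row_free_unit -kermx_eq0; apply/rowV0P => v /sub_kermxP vA0.
have : (v *m (c *: (M^T *m M) + lambda%:M) *m v^T) 0 0 = 0.
  by rewrite vA0 mul0mx mxE.
rewrite mulmxDr mulmxDl -scalemxAr -scalemxAl mul_mx_scalar -scalemxAl.
have -> : v *m (M^T *m M) *m v^T = (M *m v^T)^T *m (M *m v^T).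
  by rewrite trmx_mul trmxK !mulmxA.
have -> : v *m v^T = v^T^T *m v^T by rewrite trmxK.
rewrite mxE [X in X + _]mxE [X in _ + X]mxE -!norm2_sqr_mul => vAv0.
apply: trmx_inj; rewrite trmx0; apply: norm2_eq0.
have cM_ge0 := mulr_ge0 c_ge0 (sqr_ge0 (norm2 (M *m v^T))).
have lv_ge0 := mulr_ge0 (ltW lambda_gt0) (sqr_ge0 (norm2 v^T)).
have /eqP : lambda * norm2 v^T ^+ 2 = 0 by lra.
by rewrite mulf_eq0 gt_eqF //= => /eqP.
Qed.

(** Keeping the residual on the right exhibits [b] as a multiple of a vector in the range of [M^T],
    from which its support is later read off. *)
Lemma ridge_normal_eq :
  exists b : 'cV[R]_p, lambda *: b = c *: (M^T *m (y - M *m b)).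
Proof.
exists (invmx (c *: (M^T *m M) + lambda%:M) *m (c *: (M^T *m y))).
set b := _ *m _.
have : (c *: (M^T *m M) + lambda%:M) *m b = c *: (M^T *m y).
  by rewrite mulKVmx // ridge_unitmx.
rewrite mulmxDl mul_scalar_mx -scalemxAl -mulmxA mulmxBr scalerBr => <-.
by rewrite addrAC subrr add0r.
Qed.

Lemma ridge_min (b b' : 'cV[R]_p) :
  lambda *: b = c *: (M^T *m (y - M *m b)) ->
  c * norm2 (y - M *m b) ^+ 2 + lambda * norm2 b ^+ 2 <=
  c * norm2 (y - M *m b') ^+ 2 + lambda * norm2 b' ^+ 2.
Proof.
move=> normal_eq; pose h := b - b'.
have -> : y - M *m b' = (y - M *m b) + M *m h.
  by rewrite mulmxBr addrA subrK.
have -> : b' = b + - h by rewrite opprB addrC subrK.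
rewrite !norm2_sqrD.
(* Pairing the normal equation with [h] cancels the two terms linear in [h]; only nonnegative
   squares remain. *)
have cross : c * ((M *m h)^T *m (y - M *m b)) 0 0 = lambda * (h^T *m b) 0 0.
  have := congr1 (fun u => (h^T *m u) 0 0) normal_eq => /=.
  by rewrite -!scalemxAr mulmxA -trmx_mul !mxE => <-.
have -> : ((- h)^T *m b) 0 0 = - (h^T *m b) 0 0.
  by rewrite linearN mulNmx mxE.
have cMh_ge0 := mulr_ge0 c_ge0 (sqr_ge0 (norm2 (M *m h))).
have lh_ge0 := mulr_ge0 (ltW lambda_gt0) (sqr_ge0 (norm2 (- h))).
lra.
Qed.

End Ridge.

Section Support.

Variables (R : realType) (p : nat).
Implicit Types (beta : 'cV[R]_p) (S : {set 'I_p}).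

Definition support beta : {set 'I_p} := [set i | beta i 0 != 0].

(** A square matrix keeps every restricted problem in dimension [p], without reindexing by [S]. *)
Definition proj S : 'M[R]_p := diag_mx (\row_i (i \in S)%:R).

Lemma projE S beta i : (proj S *m beta) i 0 = (i \in S)%:R * beta i 0.
Proof. by rewrite mul_diag_mx !mxE. Qed.

Lemma proj_id S beta : (proj S *m beta = beta) <-> support beta \subset S.
Proof.
split=> [pb | /fintype.subsetP sub].
  apply/fintype.subsetP => i; rewrite inE -pb projE; case: (i \in S) => //.
  by rewrite mul0r eqxx.
apply/matrixP => i j; rewrite ord1 projE; have := sub i; rewrite inE.
case: eqVneq => [-> _|_ ->//]; first by rewrite mulr0.
by rewrite mul1r.
Qed.

Lemma projK S : proj S *m proj S = proj S.
Proof.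
rewrite mul_diag_mx; apply/matrixP => i j; rewrite !mxE.
by case: (i \in S); rewrite ?mul1r ?mul0r ?mul0rn.
Qed.

Lemma sum_support beta :
  \sum_(i < p) (beta i 0 != 0)%:R = #|support beta|%:R :> R.
Proof.
rewrite -natr_sum -sum1_card [in RHS]big_mkcond; congr _%:R.
by apply: eq_bigr => i _; rewrite inE; case: eqP.
Qed.

(** The indicators count the zero entries, [p] minus the support size. For [p = 0] the convention
    [0^-1 = 0] would break the equivalence. *)
Lemma sparse_feasibleP (k : nat) beta : (0 < p)%N ->
  sparse_feasible k beta <-> (#|support beta| <= k)%N.
Proof.
move=> p_gt0; rewrite /sparse_feasible /=.
have -> : \sum_(i < p) (`|beta i 0| <= 0)%R%:R = p%:R - #|support beta|%:R :> R.
  rewrite -sum_support -[in p%:R](card_ord p) -sum1_card natr_sum -sumrB.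
  by apply: eq_bigr => i _; rewrite normr_le0; case: eqVneq; rewrite ?subr0 ?subrr.
have pR_neq0 : p%:R != 0 :> R by rewrite pnatr_eq0 -lt0n.
rewrite mulrBr mulVf // lerD2l lerN2 [leRHS]mulrC.
by rewrite ler_pM2l ?invr_gt0 ?ltr0n // ler_nat.
Qed.

End Support.

Lemma sparse_min_exists (R : realType) (n p k : nat) (lambda : R)
    (X : 'M[R]_(n, p)) (y : 'cV[R]_n) : 0 < lambda ->
  exists2 b : 'cV[R]_p, (#|support b| <= k)%N &
    forall beta, (#|support beta| <= k)%N ->
      sparse_objective lambda X y b <= sparse_objective lambda X y beta.
Proof.
move=> lambda_gt0.
have n_ge0 : 0 <= n%:R^-1 :> R by rewrite invr_ge0 ler0n.
have ridgeS (S : {set 'I_p}) : exists b : 'cV[R]_p, support b \subset S /\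
    forall beta, support beta \subset S ->
      sparse_objective lambda X y b <= sparse_objective lambda X y beta.
  have [b normal_eq] := ridge_normal_eq (X *m proj R S) y n_ge0 lambda_gt0.
  (* The normal equation puts [b] in the range of [(X *m proj R S)^T], hence of the symmetric
     idempotent [proj R S], which therefore fixes it. *)
  have pb : proj R S *m b = b.
    apply: (scalerI (lt0r_neq0 lambda_gt0)).
    rewrite scalemxAr normal_eq -scalemxAr mulmxA; congr (_ *: (_ *m _)).
    by rewrite trmx_mul tr_diag_mx mulmxA projK.
  exists b; split=> [|beta /proj_id pbeta]; first exact/proj_id.
  (* The projection fixes both [b] and [beta], so the designs [X *m proj R S] and [X] give them the
     same objective. *)
  have := ridge_min n_ge0 lambda_gt0 beta normal_eq.
  by rewrite -!mulmxA pb pbeta.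
have [b bP] := boolp.choice ridgeS.
have card0 : (#|@finset.set0 'I_p| <= k)%N by rewrite cards0.
case: (@arg_minP _ _ _ (@finset.set0 'I_p) (fun S => #|S| <= k)%N
        (fun S => sparse_objective lambda X y (b S)) card0) => S cardS minS.
exists (b S) => [|beta card_beta].
  by apply: leq_trans cardS; apply: subset_leq_card; case: (bP S).
(* Any competitor is beaten by the ridge solution for its own support. *)
by apply: (le_trans (minS _ card_beta)); case: (bP (support beta)) => _; apply.
Qed.

(** Where [z] vanishes the cone constraint kills [beta], so [z] dominates the support indicator. *)
Lemma misoc_relax (R : realType) (n p k : nat) (lambda : R)
    (X : 'M[R]_(n, p)) (y : 'cV[R]_n) (beta mu z : 'cV[R]_p) : 0 < lambda ->
  misoc_feasible k (beta, mu, z) ->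
  (#|support beta| <= k)%N /\
  sparse_objective lambda X y beta <= misoc_objective lambda X y (beta, mu, z).
Proof.
move=> lambda_gt0 [sum_z feas]; split.
  rewrite -(ler_nat R) -sum_support; apply: le_trans sum_z.
  apply: ler_sum => i _; have [cone [] zi] := feas i; last first.
    by rewrite zi lern1 leq_b1.
  move: cone; rewrite zi mulr0 => beta_le0.
  have /eqP : beta i 0 ^+ 2 = 0 by apply/le_anti; rewrite beta_le0 sqr_ge0.
  by rewrite sqrf_eq0 => ->.
(* Where [z] is 0, [mu] may be negative, but the square of [beta] is then at most 0, hence at most
   the absolute value of [mu]. *)
rewrite lerD2l ler_pM2l // norm2_sqr; apply: ler_sum => i _.
have [cone [] zi] := feas i; apply: (le_trans cone); rewrite zi.
  by rewrite mulr0.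
by rewrite mulr1 ler_norm.
Qed.

Lemma misoc_lift (R : realType) (n p k : nat) (lambda : R)
    (X : 'M[R]_(n, p)) (y : 'cV[R]_n) (beta : 'cV[R]_p) :
  (#|support beta| <= k)%N ->
  exists2 u, misoc_feasible k u &
    misoc_objective lambda X y u = sparse_objective lambda X y beta.
Proof.
move=> card_beta.
(* This [mu] makes each cone constraint tight and, being nonnegative, has 1-norm exactly
   [norm2 beta ^+ 2]. *)
exists (beta, \col_i beta i 0 ^+ 2, \col_i (beta i 0 != 0)%:R).
  split=> [|i]; last first.
    rewrite !mxE; case: eqVneq => [->|_]; first by rewrite mulr0 expr0n; auto.
    by rewrite mulr1; auto.
  under eq_bigr do rewrite mxE.
  by rewrite sum_support ler_nat.
rewrite /misoc_objective /sparse_objective /norm1 [in RHS](norm2_sqr beta).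
congr (_ + _ * _).
by apply: eq_bigr => i _; rewrite mxE ger0_norm // sqr_ge0.
Qed.

Theorem theorem1 (R : realType) (n p k : nat) (lambda : R)
    (X : 'M[R]_(n, p)) (y : 'cV[R]_n)
    (n_gt0 : (0 < n)%N) (p_gt0 : (0 < p)%N) (k_gt0 : (0 < k)%N)
    (k_le : (k <= minn n p)%N) (lambda_gt0 : 0 < lambda) :
  exists vstar : R,
    is_min (@sparse_feasible R p k) (sparse_objective lambda X y) vstar /\
    is_min (@misoc_feasible R p k) (misoc_objective lambda X y) vstar.
Proof.
have [b card_b b_min] := sparse_min_exists k X y lambda_gt0.
exists (sparse_objective lambda X y b); split; split.
- by exists b => //; apply/sparse_feasibleP.
- by move=> _ [beta /(sparse_feasibleP _ _ p_gt0) /b_min ? <-].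
- by have [u] := misoc_lift lambda X y card_b; exists u.
- move=> _ [[[beta mu] z] feas <-].
  have [card_beta le_obj] :=
    misoc_relax X y lambda_gt0 feas.
  exact: le_trans (b_min _ card_beta) le_obj.
Qed.
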